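(* Let $A\in\mathcal{Z}(1)$. There exists a positive integer $\mathcal{L}$ such that for every real number $x\ge\mathcal{L}$, $$|\mathcal{D}_A(x)|=2+\sum_{l=1}^4\left\lfloor\frac{\log(\lfloor x\rfloor-R_l+1-Q_l)-\log P_l+\log(2\sqrt\tau)}{\log(\alpha+\beta\sqrt\tau)}\right\rfloor,$$ where for $l\in\{1,2,3,4\}$: $$P_l=\begin{cases}1-\lambda-(-1)^l\sqrt\tau & \text{if }\lambda<(-1)^{l-1}\sqrt\tau,\\ 1+\lambda+(-1)^l\sqrt\tau & \text{if }\lambda>(-1)^{l-1}\sqrt\tau,\end{cases}$$ $$Q_l=\begin{cases}(-1)^{\lfloor\frac{l-1}{2}\rfloor}\left(\frac ED\lambda-\frac ED-\frac d2\right) & \text{if }\lambda<(-1)^{l-1}\sqrt\tau,\\ (-1)^{\lfloor\frac{l+1}{2}\rfloor}\left(\frac ED\lambda+\frac ED-\frac d2\right) & \text{if }\lambda>(-1)^{l-1}\sqrt\tau,\end{cases}$$ $$R_l=\begin{cases}1 & \text{if }-\sqrt\tau+\frac{1-(-1)^l}{2}<\lambda<\sqrt\tau-\frac{1+(-1)^l}{2},\\ 0 & \text{if }\lambda<-\sqrt\tau+\frac{1-(-1)^l}{2}\text{ or }\lambda>\sqrt\tau-\frac{1+(-1)^l}{2}.\end{cases}$$ In particular, this holds with $\mathcal{L}=\max\{M'_l: l\in\{1,2,3,4\}\}$, where $M'_l$ is the positive integer $$M'_l=\max\left\{|s_1^{(l)}|,|s_{N_0}^{(l)}|,|s_{N_l}^{(l)}|\right\}+\max\left\{|t_1^{(l)}|,|t_{N_0}^{(l)}|,|t_{N_l}^{(l)}|\right\},$$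 and the positive integers $N_0$ and $N_l$ are $$N_0=\begin{cases}\min\left\{m\in\mathbb{N}: u_m>|\lambda|v_m+\left|\frac ED\lambda-\frac d2\right|,\ v_m>\frac{|E|}{D}\right\} & \text{if }|\lambda|<\sqrt\tau,\\ \min\left\{m\in\mathbb{N}: u_m<|\lambda|v_m-\left|\frac ED\lambda-\frac d2\right|,\ v_m>\frac{|E|}{D}\right\} & \text{if }|\lambda|>\sqrt\tau,\end{cases}$$ $$N_l=\begin{cases}1 & \text{if }|\lambda|<\sqrt\tau,\\ \max\left\{1,\left\lceil\frac{\log\left(1+|\lambda|-(-1)^l\frac{|\lambda|}{\lambda}\sqrt\tau\right)-\log(2\sqrt\tau)}{\log(\alpha+\beta\sqrt\tau)}\right\rceil\right\} & \text{if }|\lambda|>\sqrt\tau.\end{cases}$$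
   Context: $\mathbb{N}$ is the set of positive integers. $\mathcal{A}$ denotes the set of all Diophantine equations $au^2+buv+cv^2+du+ev+f=0$ (unknowns $u,v$) with $a,b,c,d,e,f\in\mathbb{Z}$, $a>0$, $\gcd(a,b,c,d,e,f)=1$. For $A\in\mathcal{A}$ put $D=b^2-4ac$, $E=bd-2ae$, $F=d^2-4af$, $N=E^2-DF$. $A$ is an $LA2$-type equation if: (i) $D$ is a non-square positive integer; (ii) $D\mid E$; (iii) $2a\mid b$, $a\mid c$, $2a\mid d$; (iv) $4a^2D\mid N$. $\mathcal{Z}(1)$ is the set of $LA2$-type equations with $\frac{N}{-4a^2D}=1$ (for these, $a=1$). For $A\in\mathcal{Z}(1)$ put $\lambda=\frac b2\in\mathbb{Z}$ and $\tau=\frac D4$, a non-square positive integer. $(\alpha,\beta)\in\mathbb{N}^2$ is the fundamental solution of $\tilde u^2-\tau\tilde v^2=1$, i.e. $\alpha+\beta\sqrt\tau=\inf\{\tilde u+\tilde v\sqrt\tau:(\tilde u,\tilde v)\in\mathbb{Z}^2,\ \tilde u^2-\tau\tilde v^2=1,\ \tilde u+\tilde v\sqrt\tau>1\}$. For $m\in\mathbb{N}$, $u_m=\frac12\{(\alpha+\beta\sqrt\tau)^m+(\alpha-\beta\sqrt\tau)^m\}$ and $v_m=\frac1{2\sqrt\tau}\{(\alpha+\beta\sqrt\tau)^m-(\alpha-\beta\sqrt\tau)^m\}$ (positive integers). For $l\in\{1,2,3,4\}$, $m\in\mathbb{N}$: $s_m^{(l)}=(-1)^{\lfloor l/2\rfloor}u_m-(-1)^{\lfloor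 (l-1)/2\rfloor}\lambda v_m+\left(\frac ED\lambda-\frac d2\right)$ and $t_m^{(l)}=(-1)^{\lfloor (l-1)/2\rfloor}v_m-\frac ED$ (integers). For real $x>0$, $\mathcal{D}_A(x)$ is the set of $(u,v)\in\mathbb{Z}^2$ that satisfy equation $A$ and $|u|+|v|\le x$; $|\mathcal{D}_A(x)|$ is its cardinality. *)

(* Defs.v *)
From HB Require Import structures.
From mathcomp Require Import all_boot all_order all_algebra.
From mathcomp Require Import finmap.
From mathcomp Require Import all_classical all_reals all_analysis.

Set Implicit Arguments.
Unset Strict Implicit.
Unset Printing Implicit Defensive.

Import Order.TTheory GRing.Theory Num.Theory.
Local Open Scope classical_set_scope.
Local Open Scope ring_scope.

(* The equation a u^2 + b u v + c v^2 + d u + e v + f = 0. *)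
Record equation := Equation {
  ca : int; cb : int; cc : int; cd : int; ce : int; cf : int }.

Definition in_calA (A : equation) : Prop :=
  0 < ca A /\
  gcdz (ca A) (gcdz (cb A) (gcdz (cc A) (gcdz (cd A) (gcdz (ce A) (cf A))))) = 1.

Definition satisfies (A : equation) (p : int * int) : Prop :=
  let: (u, v) := p in
  ca A * u ^+ 2 + cb A * u * v + cc A * v ^+ 2 + cd A * u + ce A * v + cf A = 0.

Definition eqD (A : equation) : int := cb A ^+ 2 - 4 * ca A * cc A.
Definition eqE (A : equation) : int := cb A * cd A - 2 * ca A * ce A.
Definition eqF (A : equation) : int := cd A ^+ 2 - 4 * ca A * cf A.
Definition eqN (A : equation) : int := eqE A ^+ 2 - eqD A * eqF A.

Definition is_LA2 (A : equation) : Prop :=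
  [/\ 0 < eqD A /\ ~ (exists n : int, eqD A = n ^+ 2),
      (eqD A %| eqE A)%Z,
      [/\ (2 * ca A %| cb A)%Z, (ca A %| cc A)%Z & (2 * ca A %| cd A)%Z] &
      (4 * ca A ^+ 2 * eqD A %| eqN A)%Z].

Definition in_Z1 (A : equation) : Prop :=
  [/\ in_calA A, is_LA2 A &
      (eqN A)%:~R / (- (4 * ca A ^+ 2 * eqD A))%:~R = 1 :> rat].

(* The integers lambda, tau, E / D and d / 2 attached to A in Z(1) are taken
   in R, where the divisions are exact. *)
Definition lam (R : realType) (A : equation) : R := (cb A)%:~R / 2.
Definition tau (R : realType) (A : equation) : R := (eqD A)%:~R / 4.
Definition ED (R : realType) (A : equation) : R := (eqE A)%:~R / (eqD A)%:~R.
Definition d2 (R : realType) (A : equation) : R := (cd A)%:~R / 2.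
Definition sqrt_tau (R : realType) (A : equation) : R := Num.sqrt (tau R A).

Definition pell (R : realType) (A : equation) (u v : int) : Prop :=
  u%:~R ^+ 2 - tau R A * v%:~R ^+ 2 = 1 :> R.

Definition pell_val (R : realType) (A : equation) (u v : int) : R :=
  u%:~R + v%:~R * sqrt_tau R A.

Definition is_fundamental (R : realType) (A : equation) (alpha beta : int)
    : Prop :=
  [/\ 0 < alpha, 0 < beta, pell R A alpha beta &
      pell_val R A alpha beta =
      inf [set r : R | exists u v : int,
             [/\ r = pell_val R A u v, pell R A u v & 1 < r]]].

Definition useq (R : realType) (A : equation) (alpha beta : int) (m : nat)
    : R :=
  1 / 2 * (pell_val R A alpha beta ^+ m + pell_val R A alpha (- beta) ^+ m).

Definition vseq (R : realType) (A : equation) (alpha beta : int) (m : nat)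
    : R :=
  1 / (2 * sqrt_tau R A) *
  (pell_val R A alpha beta ^+ m - pell_val R A alpha (- beta) ^+ m).

(* For l >= 1, l./2 = floor (l / 2), l.-1./2 = floor ((l - 1) / 2) and
   l.+1./2 = floor ((l + 1) / 2). *)
Definition sseq (R : realType) (A : equation) (alpha beta : int) (l m : nat)
    : R :=
  (-1) ^+ l./2 * useq R A alpha beta m
  - (-1) ^+ l.-1./2 * lam R A * vseq R A alpha beta m
  + (ED R A * lam R A - d2 R A).

Definition tseq (R : realType) (A : equation) (alpha beta : int) (l m : nat)
    : R :=
  (-1) ^+ l.-1./2 * vseq R A alpha beta m - ED R A.

Definition sols (R : realType) (A : equation) (x : R) : set (int * int) :=
  [set p | satisfies A p /\ (`|p.1| + `|p.2|)%:~R <= x].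

(* In each definition by cases below the last branch covers exactly the
   remaining case(s) of the mathematical definition: lambda is an integer and
   sqrt tau is irrational, so the boundary equalities never occur. *)

Definition Pl (R : realType) (A : equation) (l : nat) : R :=
  if lam R A < (-1) ^+ l.-1 * sqrt_tau R A
  then 1 - lam R A - (-1) ^+ l * sqrt_tau R A
  else 1 + lam R A + (-1) ^+ l * sqrt_tau R A.

Definition Ql (R : realType) (A : equation) (l : nat) : R :=
  if lam R A < (-1) ^+ l.-1 * sqrt_tau R A
  then (-1) ^+ l.-1./2 * (ED R A * lam R A - ED R A - d2 R A)
  else (-1) ^+ l.+1./2 * (ED R A * lam R A + ED R A - d2 R A).

Definition Rl (R : realType) (A : equation) (l : nat) : R :=
  if (- sqrt_tau R A + (1 - (-1) ^+ l) / 2 < lam R A) &&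
     (lam R A < sqrt_tau R A - (1 + (-1) ^+ l) / 2)
  then 1 else 0.

Definition N0_cond (R : realType) (A : equation) (alpha beta : int) (m : nat)
    : Prop :=
  let u := useq R A alpha beta m in
  let v := vseq R A alpha beta m in
  let k := `|ED R A * lam R A - d2 R A| in
  (if `|lam R A| < sqrt_tau R A
   then `|lam R A| * v + k < u
   else u < `|lam R A| * v - k) /\
  `|(eqE A)%:~R| / (eqD A)%:~R < v.

Definition is_N0 (R : realType) (A : equation) (alpha beta : int) (n : nat)
    : Prop :=
  [/\ (0 < n)%N, N0_cond R A alpha beta n &
      forall m : nat, (0 < m)%N -> N0_cond R A alpha beta m -> (n <= m)%N].

Definition Nl (R : realType) (A : equation) (alpha beta : int) (l : nat)
    : nat :=
  if `|lam R A| < sqrt_tau R A then 1%N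
  else absz (Num.max 1 (Num.ceil
          ((ln (1 + `|lam R A|
                - (-1) ^+ l * (`|lam R A| / lam R A) * sqrt_tau R A)
            - ln (2 * sqrt_tau R A))
           / ln (pell_val R A alpha beta)))).

Definition Ml (R : realType) (A : equation) (alpha beta : int) (N0 l : nat)
    : R :=
  let S m := `|sseq R A alpha beta l m| in
  let T m := `|tseq R A alpha beta l m| in
  let n := Nl R A alpha beta l in
  Num.max (Num.max (S 1%N) (S N0)) (S n) + Num.max (Num.max (T 1%N) (T N0)) (T n).

Definition count_formula (R : realType) (A : equation) (alpha beta : int)
    (x : R) : int :=
  2 + \sum_(1 <= l < 5)
        Num.floor
          ((ln ((Num.floor x)%:~R - Rl R A l + 1 - Ql R A l) - ln (Pl R A l)
            + ln (2 * sqrt_tau R A))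
           / ln (pell_val R A alpha beta)).

(* Guards the use of fset_set, which is empty on infinite sets. *)
Lemma finite_sols (R : realType) (A : equation) (x : R) :
  finite_set (sols A x).
Proof.
pose n := absz (Num.floor x).
pose f (q : 'I_(n.*2.+1) * 'I_(n.*2.+1)) : int * int :=
  ((q.1 : nat)%:Z - n%:Z, (q.2 : nat)%:Z - n%:Z).
have key (z : int) : `|z| <= n%:Z ->
    exists i : 'I_(n.*2.+1), z = (i : nat)%:Z - n%:Z.
  move=> zn.
  have h0 : 0 <= z + n%:Z.
    by rewrite -lerBlDr sub0r; move: zn; rewrite ler_norml => /andP[].
  have h1 : (absz (z + n%:Z)%R < n.*2.+1)%N.
    rewrite ltnS -lez_nat gez0_abs// -addnn PoszD lerD2r.
    by move: zn; rewrite ler_norml => /andP[].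
  by exists (Ordinal h1); rewrite /= gez0_abs// addrK.
apply: (@sub_finite_set _ _ (f @` setT)); last first.
  by apply: finite_image; exact: finite_finset.
move=> [u v] [_ /=]; rewrite -floor_ge_int => le_x.
have le_n : `|u| + `|v| <= n%:Z.
  by apply: (le_trans le_x); rewrite /n abszE ler_norm.
have [i ->] := key u (le_trans (ler_wpDr (normr_ge0 v) (lexx _)) le_n).
have [j ->] := key v (le_trans (ler_wpDl (normr_ge0 u) (lexx _)) le_n).
by exists (i, j).
Qed.

(* Main.v *)
(* Substituting X = u + lambda v + d/2 and Y = v + E/D turns the equation into
   the Pell equation X^2 - tau Y^2 = 1 over the integers, whose solutions are
   (1, 0), (-1, 0) and the four families (+-u_m, +-v_m), m >= 1, i.e.
   (s_m^(l), t_m^(l)) in the original unknowns.  From index N_0 on, s_m^(l) and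
   t_m^(l) have constant sign, so |s_m| + |t_m| = p u_m + q v_m + Q_l for
   integers p, q; with w = alpha + beta sqrt tau and r = sqrt tau,
     2 r (p u_m + q v_m) = (p r + q) w^m + (p r - q) w^-m,   p r + q = P_l,
   and from N_l on the conjugate term is at most 2 r in absolute value, so that
   |s_m| + |t_m| <= n amounts to P_l w^m <= 2 r (n - R_l + 1 - Q_l), R_l being 1
   exactly when p r - q > 0.  Since s_m^(l) and t_m^(l) are monotone in m >= 1,
   M'_l bounds all the terms before max(N_0, N_l), where both inequalities hold
   anyway. *)
Require Import Defs.
From HB Require Import structures.
From mathcomp Require Import all_boot all_order all_algebra.
From mathcomp Require Import finmap.
From mathcomp Require Import all_classical all_reals all_analysis.
From mathcomp Require Import zify ring lra.

Set Implicit Arguments.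
Unset Strict Implicit.
Unset Printing Implicit Defensive.

Import Order.TTheory GRing.Theory Num.Theory.
Local Open Scope classical_set_scope.
Local Open Scope ring_scope.

(** * Normal form of the equations in Z(1) *)

(* The parameters are lambda, tau, E/D and d/2. *)
Definition normal_equation (k t e d : int) : equation :=
  Equation 1 (2 * k) (k ^+ 2 - t) (2 * d) (2 * (k * d - t * e))
    (d ^+ 2 - t * e ^+ 2 - 1).

(** The divisibilities give [b = 2 a k], [c = a c'], [d = 2 a d'], hence [D = 4 a^2 t] with
    [t = k^2 - c']. Then [E = z D] determines [e], and [N = - 4 a^2 D] determines [f], both as
    multiples of [a]. So [a] divides all six coefficients, and coprimality gives [a = 1]. *)
Lemma Z1_normal_form (A : equation) : in_Z1 A ->
  exists k t e d : int,
    [/\ A = normal_equation k t e d, 0 < t & forall n : int, t <> n ^+ 2].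
Proof.
case=> -[a0 gA] [[D0 Dn] DE [ab ac ad] _] NE.
have a0' : ca A != 0 by rewrite gt_eqF.
have NE' : eqN A = - (4 * ca A ^+ 2 * eqD A).
  have D1 : (- (4 * ca A ^+ 2 * eqD A))%:~R != 0 :> rat.
    by rewrite intr_eq0 oppr_eq0 !mulf_neq0// gt_eqF.
  apply/(@intr_inj rat)/(divIf D1).
  by rewrite NE divff.
move: A gA D0 Dn DE ab ac ad NE' a0 a0' {NE} => [a b c d e f] /=.
rewrite /eqN /Defs.eqE /eqF /eqD /=.
move=> gA D0 Dn /dvdzP[z DE] /dvdzP[k bE] /dvdzP[c' cE] /dvdzP[d' dE] NE a0 a0'.
subst b c d.
pose t := k ^+ 2 - c'.
have DE' : (k * (2 * a)) ^+ 2 - 4 * a * (c' * a) = 4 * a ^+ 2 * t.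
  by rewrite /t; ring.
rewrite DE' in D0 Dn DE NE.
have cE : c' = k ^+ 2 - t by rewrite /t; ring.
have D0' : 4 * a ^+ 2 * t != 0 by rewrite gt_eqF.
clearbody t; clear DE'.
have eE : e = (2 * a) * (k * d' - t * z).
  apply: (@mulfI _ (2 * a)); first by rewrite mulf_neq0.
  have -> : 2 * a * e = k * (2 * a) * (d' * (2 * a)) - z * (4 * a ^+ 2 * t).
    by rewrite -DE; ring.
  ring.
have fE : f = a * (d' ^+ 2 - t * z ^+ 2 - 1).
  rewrite DE in NE.
  (* The factor is [4 a D], the coefficient of [f] in [N]. *)
  apply: (@mulfI _ (4 * a * (4 * a ^+ 2 * t))); first by rewrite mulf_neq0// mulf_neq0.
  apply: subr0_eq; move: NE => /eqP; rewrite -subr_eq0 => /eqP <-; ring.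
have a1 : a = 1.
  have : (a %| (1%R : int))%Z.
    rewrite -gA !dvdz_gcd; apply/and5P; split=> //.
    - by apply: dvdz_mull; exact: dvdz_mull.
    - exact: dvdz_mull.
    - by apply: dvdz_mull; exact: dvdz_mull.
    - rewrite eE fE; apply/andP; split; last exact: dvdz_mulr.
      by apply: dvdz_mulr; exact: dvdz_mull.
  by rewrite dvdz1 => /eqP; clear -a0; lia.
exists k, t, z, d'; split.
- by rewrite eE fE a1 cE /normal_equation; congr Equation; ring.
- by move: D0; rewrite a1; clear; lia.
- by move=> n tE; apply: Dn; exists (2 * n); rewrite exprMn -tE a1; ring.
Qed.

Lemma satisfies_normal_form (k t e d u v : int) :
  satisfies (normal_equation k t e d) (u, v) <->
  (u + k * v + d) ^+ 2 - t * (v + e) ^+ 2 = 1.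
Proof.
rewrite /satisfies /=; set F := (X in X = 0).
have -> : (u + k * v + d) ^+ 2 - t * (v + e) ^+ 2 = F + 1 by rewrite /F; ring.
by split=> [->|/eqP]; [rewrite add0r | rewrite -subr_eq0 addrK => /eqP].
Qed.

(** * Powers of the fundamental unit and solutions of the Pell equation *)

(** The pair (u_m, v_m) kept in the integers: repeated multiplication by [a + b sqrt t], starting
    from 1. *)
Fixpoint pell_pow (t a b : int) (m : nat) : int * int :=
  if m is m'.+1 then
    let p := pell_pow t a b m' in (a * p.1 + t * b * p.2, b * p.1 + a * p.2)
  else (1, 0).

Section PellPowers.
Variables (R : realType) (t a b : int).
Hypotheses (t_gt0 : 0 < t) (a_gt0 : 0 < a) (b_gt0 : 0 < b).
Hypothesis ab1 : a ^+ 2 - t * b ^+ 2 = 1.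

Local Notation r := (@Num.sqrt R t%:~R).
Local Notation w := (a%:~R + b%:~R * r).
Local Notation U m := (pell_pow t a b m).1.
Local Notation V m := (pell_pow t a b m).2.

Lemma sqr_sqrt_int : r ^+ 2 = t%:~R.
Proof. by rewrite sqr_sqrtr// ler0z ltW. Qed.

Lemma sqrt_int_gt0 : 0 < r.
Proof. by rewrite sqrtr_gt0 ltr0z. Qed.

Lemma sqrt_int_ge1 : 1 <= r.
Proof.
by rewrite -(@ler_pXn2r _ 2)// ?nnegrE ?sqrtr_ge0// sqr_sqrt_int expr1n ler1z.
Qed.

Lemma pell_conjM (X Y : int) : X ^+ 2 - t * Y ^+ 2 = 1 ->
  (X%:~R + Y%:~R * r) * (X%:~R - Y%:~R * r) = 1.
Proof.
move=> XY; rewrite mulrC -subr_sqr exprMn sqr_sqrt_int mulrC -!rmorphXn /=.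
by rewrite -intrM -intrB XY.
Qed.

(** The conjugate [a - b r] is the inverse of [w], hence positive; so [a > b r] and
    [w > 2 b r >= 2 r]. *)
Lemma pell_unit_gt : 2 * r < w.
Proof.
have h := pell_conjM ab1; have r0 := sqrt_int_gt0.
have b1 : 1 <= b%:~R :> R by rewrite ler1z.
have a1 : 1 <= a%:~R :> R by rewrite ler1z.
have : 0 < a%:~R - b%:~R * r :> R.
  by rewrite -(@pmulr_rgt0 _ w) ?h// addr_gt0 ?mulr_gt0// ltr0z.
nra.
Qed.

Lemma pell_unit_gt1 : 1 < w.
Proof. have := pell_unit_gt; have := sqrt_int_ge1; lra. Qed.

Lemma pell_unitV : w^-1 = a%:~R - b%:~R * r.
Proof.
have w0 : w != 0 by rewrite gt_eqF// (lt_trans _ pell_unit_gt1).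
by apply: (mulfI w0); rewrite divff// pell_conjM.
Qed.

Lemma pell_powP m : U m ^+ 2 - t * V m ^+ 2 = 1.
Proof.
elim: m => [|m IH] /=; first by rewrite expr0n mulr0 subr0 expr1n.
by rewrite -[RHS]mulr1 -{1}ab1 -IH; ring.
Qed.

Lemma pell_powD m : (U m)%:~R + (V m)%:~R * r = w ^+ m.
Proof.
elim: m => [|m IH] /=; first by rewrite mul0r addr0.
rewrite exprS -IH !(intrD, intrM).
move: sqr_sqrt_int; set s := r => <-; ring.
Qed.

Lemma pell_powB m : (U m)%:~R - (V m)%:~R * r = w^-1 ^+ m.
Proof.
rewrite pell_unitV; elim: m => [|m IH] /=; first by rewrite mul0r subr0.
rewrite exprS -IH !(intrD, intrM).
move: sqr_sqrt_int; set s := r => <-; ring.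
Qed.

Lemma pell_powU m : (U m)%:~R = (w ^+ m + w^-1 ^+ m) / 2.
Proof. by rewrite -pell_powD -pell_powB; field. Qed.

Lemma pell_powV m : (V m)%:~R = (w ^+ m - w^-1 ^+ m) / (2 * r).
Proof.
by rewrite -pell_powD -pell_powB; field; rewrite gt_eqF// sqrt_int_gt0.
Qed.

Lemma pell_pow_ge0 m : 0 < U m /\ 0 <= V m.
Proof.
elim: m => [//|m [U0 V0]] /=.
by split; [rewrite ltr_pwDl ?mulr_gt0// !mulr_ge0// ltW
          |rewrite addr_ge0// mulr_ge0// ltW].
Qed.

Lemma ltr_pell_powV : {homo (fun m => V m) : m n / (m < n)%N >-> m < n}.
Proof.
apply: homo_ltn => [x y z|m] /=; first exact: lt_trans.
have [] := pell_pow_ge0 m; nia.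
Qed.

Lemma pell_powV_inj : injective (fun m => V m).
Proof.
move=> m n /= mn; have [mLn|nLm|//] := ltngtP m n.
- by have := ltr_pell_powV mLn; rewrite mn ltxx.
- by have := ltr_pell_powV nLm; rewrite mn ltxx.
Qed.

Lemma pell_powV_gt0 m : (0 < m)%N -> 0 < V m.
Proof. by move=> /ltr_pell_powV. Qed.

Lemma pell_powV_ge m : m%:Z <= V m.
Proof.
elim: m => [//|m IH]; have := ltr_pell_powV (ltnSn m).
by rewrite -addn1 PoszD; lia.
Qed.

Hypothesis w_min : forall X Y : int, X ^+ 2 - t * Y ^+ 2 = 1 ->
  1 < X%:~R + Y%:~R * r :> R -> w <= X%:~R + Y%:~R * r.

(* Descent: dividing [X + Y sqrt t > 1] by [w] yields a solution
   [X' + Y' sqrt t >= 1] with [Y' < Y]. *)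
Lemma pell_pow_complete_ge0 (X Y : int) : X ^+ 2 - t * Y ^+ 2 = 1 ->
  0 < X -> 0 <= Y -> exists m, (X, Y) = pell_pow t a b m.
Proof.
have [n] := ubnP `|Y|%N; elim: n X Y => // n IH X Y; rewrite ltnS => Yn XY X0 Y0.
have [Y00|YN0] := eqVneq Y 0.
  exists 0%N; congr pair => //; nia.
have {YN0} Y0' : 0 < Y by lia.
(* The coordinates of [(X + Y r) / w], since [w^-1 = a - b r]. *)
set X' := a * X - t * b * Y; set Y' := a * Y - b * X.
have r0 := sqrt_int_gt0.
have w1 := pell_unit_gt1.
set z : R := X%:~R + Y%:~R * r.
have z1 : 1 < z.
  have : 1 <= X%:~R :> R by rewrite ler1z.
  have : 0 < Y%:~R * r by rewrite mulr_gt0// ltr0z.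
  rewrite /z; lra.
have wz := w_min XY z1; rewrite -/z in wz.
have XY' : X' ^+ 2 - t * Y' ^+ 2 = 1.
  rewrite -[RHS]mulr1 -{1}ab1 -XY /X' /Y'; ring.
have zE : X'%:~R + Y'%:~R * r = z / w.
  rewrite pell_unitV !(intrB, intrM) /z.
  by move: sqr_sqrt_int; set s := r => <-; ring.
have zV : X'%:~R - Y'%:~R * r = w / z.
  have -> : w / z = (z / w)^-1 by rewrite invf_div.
  rewrite -zE; apply/(@mulfI _ (X'%:~R + Y'%:~R * r)).
    by rewrite zE gt_eqF// divr_gt0//; lra.
  by rewrite pell_conjM// divff// zE gt_eqF// divr_gt0//; lra.
have zVz : X%:~R - Y%:~R * r = z^-1.
  by apply/(@mulfI _ z); [rewrite gt_eqF//; lra | rewrite pell_conjM// divff// gt_eqF//; lra].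
have z0 : 0 < z by lra.
have w0 : 0 < w by lra.
(* [2 X'] and [2 Y' r] are the sum and the difference of [z / w] and [w / z], and
   [2 Y r = z - z^-1]. So [h1], [h2], [h3] give [X' > 0] and [Y' >= 0], while [h4] and [h5] give
   [Y' < Y]. *)
have h1 : 1 <= z / w by rewrite ler_pdivlMr// mul1r.
have h2 : w / z <= 1 by rewrite ler_pdivrMr// mul1r.
have h3 : 0 < w / z by rewrite divr_gt0.
have h4 : z / w < z by rewrite ltr_pdivrMr// ltr_pMr.
have h5 : z^-1 < w / z by rewrite -{1}[z^-1]mul1r ltr_pM2r// invr_gt0.
have X'0 : 0 < X' by rewrite -(ltr0z R); lra.
have Y'0 : 0 <= Y' by rewrite -(ler0z R) -(pmulr_lge0 _ r0); lra.
have Y'Y : Y' < Y.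
  by rewrite -(ltr_int R) -(ltr_pM2r r0); rewrite /z in h4 zE *; lra.
have Y'n : (`|Y'| < n)%N by clear -Yn Y'0 Y'Y; lia.
have [m mE] := IH X' Y' Y'n XY' X'0 Y'0.
exists m.+1; rewrite /= -mE /X' /Y' /=; congr pair.
- rewrite -[LHS]mulr1 -ab1; ring.
- rewrite -[LHS]mulr1 -ab1; ring.
Qed.

Lemma pell_pow_complete (X Y : int) : X ^+ 2 - t * Y ^+ 2 = 1 ->
  exists m, (`|X|, `|Y|) = pell_pow t a b m.
Proof.
move=> XY; apply: pell_pow_complete_ge0 => //; last by rewrite normr_gt0; nia.
by rewrite !real_normK ?num_real.
Qed.

End PellPowers.

(** * Linear forms in u_m and v_m: comparison with an integer, monotonicity *)

(** With [P = P_l], [c = 2 r] and [y = n - R_l + 1 - Q_l], the floor is the l-th summand of the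
    counting formula. *)
Lemma le_floor_log (R : realType) (w P y c : R) (m : nat) :
  1 < w -> 0 < P -> 0 < y -> 0 < c ->
  (m%:Z <= Num.floor ((ln y - ln P + ln c) / ln w)) = (P * w ^+ m <= c * y).
Proof.
move=> w1 P0 y0 c0; have w0 : 0 < w by lra.
rewrite floor_ge_int ler_pdivlMr ?ln_gt0// -pmulrn mulr_natl -lnXn//.
rewrite addrAC -lnM ?posrE// lerBrDr -lnM ?posrE ?exprn_gt0//.
by rewrite ler_ln ?posrE ?mulr_gt0 ?exprn_gt0// mulrC [y * c]mulrC.
Qed.

Section PellLinearForms.
Variables (R : realType) (t a b : int).
Hypotheses (t_gt0 : 0 < t) (a_gt0 : 0 < a) (b_gt0 : 0 < b).
Hypothesis ab1 : a ^+ 2 - t * b ^+ 2 = 1.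

Local Notation r := (@Num.sqrt R t%:~R).
Local Notation w := (a%:~R + b%:~R * r).
Local Notation U m := (pell_pow t a b m).1.
Local Notation V m := (pell_pow t a b m).2.

Lemma pell_lin (p q : int) m :
  2 * r * (p * U m + q * V m)%:~R =
  (p%:~R * r + q%:~R) * w ^+ m + (p%:~R * r - q%:~R) * w^-1 ^+ m.
Proof.
have r0 := sqrt_int_gt0 R t_gt0.
rewrite intrD !intrM (pell_powU R t_gt0 a_gt0 b_gt0 ab1).
rewrite (pell_powV R t_gt0 a_gt0 b_gt0 ab1).
by field; rewrite gt_eqF.
Qed.

(* By [pell_lin], [p U + q V] is [(p r + q) w ^ m / (2 r)] plus a conjugate term
   of the sign of [D] and at most 1 in absolute value, hence the rounding of the
   former up (D > 0) or down (D < 0). *)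
Lemma le_pell_lin (p q n : int) (m : nat) (D := p%:~R * r - q%:~R) :
  D != 0 -> - (2 * r * w ^+ m) <= D < 2 * r * w ^+ m ->
  (p * U m + q * V m <= n) =
  ((p%:~R * r + q%:~R) * w ^+ m <=
   2 * r * (n%:~R - (if 0 < D then 1 else 0) + 1)).
Proof.
have r0 := sqrt_int_gt0 R t_gt0.
have w1 := pell_unit_gt1 R t_gt0 a_gt0 b_gt0 ab1.
move=> D0 /andP[Dge Dlt]; set I := p * U m + q * V m.
have wm0 : 0 < w ^+ m by rewrite exprn_gt0//; lra.
have := pell_lin p q m; rewrite -/I -/D; set Pw := _ * w ^+ m => IE.
set c := D * w^-1 ^+ m in IE.
have wV : w ^+ m * w^-1 ^+ m = 1 by rewrite -exprMn divff ?expr1n// gt_eqF//; lra.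
have wVm0 : 0 < w^-1 ^+ m by rewrite exprn_gt0// invr_gt0; lra.
(* Multiplying the bounds on [D] by [w^-1 ^+ m] gives [- 2 r <= c < 2 r]. The strict upper bound
   serves the second implication for [D > 0], the lower bound the first implication for [D < 0]. *)
have rE : 2 * r = 2 * r * w ^+ m * w^-1 ^+ m by rewrite -mulrA wV mulr1.
have c_lt : c < 2 * r by rewrite rE ltr_pM2r.
have c_ge : - (2 * r) <= c by rewrite rE -mulNr ler_pM2r.
have Ilt : (I < n + 1) = (I <= n) by clear; lia.
have [Dpos|Dneg] := ltP 0 D.
- have cpos : 0 < c by rewrite mulr_gt0.
  apply/idP/idP => [In|Pn].
    have : 2 * r * I%:~R <= 2 * r * n%:~R by rewrite ler_pM2l ?mulr_gt0// ler_int.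
    lra.
  rewrite -Ilt -(ltr_int R) intrD -(ltr_pM2l (mulr_gt0 (ltr0n _ 2) r0)).
  lra.
- have cneg : c < 0 by rewrite pmulr_llt0// lt_neqAle D0.
  apply/idP/idP => [In|Pn].
    have : 2 * r * I%:~R <= 2 * r * n%:~R by rewrite ler_pM2l ?mulr_gt0// ler_int.
    lra.
  rewrite -Ilt -(ltr_int R) intrD -(ltr_pM2l (mulr_gt0 (ltr0n _ 2) r0)).
  lra.
Qed.

(** From [K] on, [le_pell_lin] turns the comparison into an exponential inequality, and
    [le_floor_log] into [m <= z]. Up to [K] both sides are true: the left one by hypothesis, the
    right one because the inequality at [K] is inherited by smaller powers of [w]. *)
Lemma le_floor_pell_lin (p q Q n : int) (K : nat) (f : nat -> int)
    (D := p%:~R * r - q%:~R) :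
  (0 < K)%N -> 0 < p%:~R * r + q%:~R ->
  D != 0 -> - (2 * r * w ^+ K) <= D < 2 * r * w ^+ K ->
  (forall m, (0 < m <= K)%N -> f m <= n) ->
  (forall m, (K <= m)%N -> f m = p * U m + q * V m + Q) ->
  let z := Num.floor ((ln (n%:~R - (if 0 < D then 1 else 0) + 1 - Q%:~R)
                       - ln (p%:~R * r + q%:~R) + ln (2 * r)) / ln w) in
  0 <= z /\ forall m, (0 < m)%N -> (f m <= n) = (m%:Z <= z).
Proof.
have r0 := sqrt_int_gt0 R t_gt0.
have w1 := pell_unit_gt1 R t_gt0 a_gt0 b_gt0 ab1.
move=> K0 P0 D0 /andP[Dge Dlt] fle fE z.
have w0 : 0 < w by lra.
have wmono m : (K <= m)%N -> w ^+ K <= w ^+ m by move=> ?; rewrite ler_weXn2l// ltW.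
have wmono2 m : (K <= m)%N -> 2 * r * w ^+ K <= 2 * r * w ^+ m.
  by move=> Km; rewrite ler_pM2l ?mulr_gt0// wmono.
have big m : (K <= m)%N -> (f m <= n) = ((p%:~R * r + q%:~R) * w ^+ m <=
     2 * r * (n%:~R - (if 0 < D then 1 else 0) + 1 - Q%:~R)).
  move=> Km; have wm := wmono2 _ Km; rewrite fE// -lerBrDr le_pell_lin//; last first.
    by rewrite -/D; apply/andP; split; lra.
  by rewrite intrB; congr (_ <= _ * _); rewrite /D; lra.
have bigK : (p%:~R * r + q%:~R) * w ^+ K <=
     2 * r * (n%:~R - (if 0 < D then 1 else 0) + 1 - Q%:~R).
  by rewrite -big// fle// K0 leqnn.
(* [ln] is a logarithm only on positive arguments; the inequality at [K], whose left side is
   positive, provides this. *)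
have y0 : 0 < n%:~R - (if 0 < D then 1 else 0) + 1 - Q%:~R :> R.
  have := lt_le_trans (mulr_gt0 P0 (exprn_gt0 K w0)) bigK.
  by rewrite pmulr_rgt0// mulr_gt0.
have zE m : (m%:Z <= z) = ((p%:~R * r + q%:~R) * w ^+ m <=
     2 * r * (n%:~R - (if 0 < D then 1 else 0) + 1 - Q%:~R)).
  by apply: le_floor_log => //; rewrite mulr_gt0.
have small m : (m <= K)%N -> m%:Z <= z.
  move=> mK; rewrite zE; apply: le_trans bigK.
  by rewrite ler_pM2l// ler_weXn2l// ltW.
split; first exact: (small 0%N).
move=> m m0; have [Km|mK] := leqP K m; first by rewrite zE big.
by rewrite small ?fle ?m0// ltnW.
Qed.

(* This is [(r - c) w ^ (2m + 1) > r + c], which for [0 < r + c] follows from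
   [(r - c) (r + c) >= 1] and [w > 2 r > r + c]. *)
Lemma pell_lin_step_gt0 (c : int) m : (0 < m)%N -> c%:~R < r ->
  U m - c * V m < U m.+1 - c * V m.+1.
Proof.
have r0 := sqrt_int_gt0 R t_gt0.
have w1 := pell_unit_gt1 R t_gt0 a_gt0 b_gt0 ab1.
move=> m0 cr; have w2r := pell_unit_gt R t_gt0 a_gt0 b_gt0 ab1.
rewrite -(ltr_int R) -(ltr_pM2l (mulr_gt0 (ltr0n _ 2) r0)).
have E j : U j - c * V j = 1 * U j + (- c) * V j by ring.
rewrite !{}E !pell_lin intrN mul1r opprK.
have w0 : 0 < w by lra.
have x0 : 0 < w ^+ m by rewrite exprn_gt0.
have y0 : 0 < w^-1 ^+ m.+1 by rewrite exprn_gt0// invr_gt0.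
have yE : w^-1 ^+ m = w * w^-1 ^+ m.+1.
  by rewrite exprS mulrA divff ?mul1r// gt_eqF.
have xy : w * (w ^+ m * w^-1 ^+ m.+1) = 1.
  by rewrite mulrA -exprS -exprMn divff ?expr1n// gt_eqF.
have wx : w <= w ^+ m by rewrite -[leLHS]expr1 ler_weXn2l// ltW.
rewrite exprS [in X in X < _]yE.
move: (w ^+ m) (w^-1 ^+ m.+1) x0 y0 xy wx {yE} => x y x0 y0 xy wx.
suff H : 0 < (r - c%:~R) * x - (r + c%:~R) * y.
  have : 0 < (w - 1) * ((r - c%:~R) * x - (r + c%:~R) * y).
    by rewrite mulr_gt0// subr_gt0.
  lra.
have [rc|rc] := leP (r + c%:~R) 0.
  have : 0 < (r - c%:~R) * x by rewrite mulr_gt0// subr_gt0.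
  have : (r + c%:~R) * y <= 0 by rewrite mulr_le0_ge0// ltW.
  lra.
have h1 : 1 <= (r - c%:~R) * (r + c%:~R).
  have : 0 < (r - c%:~R) * (r + c%:~R) by rewrite mulr_gt0// subr_gt0.
  rewrite -subr_sqr sqr_sqrt_int// -rmorphXn -rmorphB/= ltr0z ler1z; clear; lia.
have h2 : (r + c%:~R) * y < 1.
  suff : (r + c%:~R) * y < w * x * y by rewrite -mulrA xy.
  rewrite ltr_pM2r//.
  have : w <= w * x by rewrite ler_peMr//; lra.
  lra.
have : (r + c%:~R) * ((r + c%:~R) * y) < (r + c%:~R) * ((r - c%:~R) * x).
  apply: (@lt_le_trans _ _ (r + c%:~R)); first by rewrite gtr_pMr.
  have : x <= ((r - c%:~R) * (r + c%:~R)) * x by rewrite ler_peMl// ltW.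
  lra.
by rewrite ltr_pM2l// subr_gt0.
Qed.

(** By [pell_lin], [2 r (U - c V) = (r - c) w^m + (r + c) w^-m], and for [c > r] both terms decrease
    in [m]. *)
Lemma pell_lin_step_lt0 (c : int) m : r < c%:~R ->
  U m.+1 - c * V m.+1 < U m - c * V m.
Proof.
have r0 := sqrt_int_gt0 R t_gt0.
have w1 := pell_unit_gt1 R t_gt0 a_gt0 b_gt0 ab1.
move=> cr; rewrite -(ltr_int R) -(ltr_pM2l (mulr_gt0 (ltr0n _ 2) r0)).
have E j : U j - c * V j = 1 * U j + (- c) * V j by ring.
rewrite !{}E !pell_lin intrN mul1r opprK.
have w0 : 0 < w by lra.
have x0 : 0 < w ^+ m by rewrite exprn_gt0.
have y0 : 0 < w^-1 ^+ m.+1 by rewrite exprn_gt0// invr_gt0.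
have yE : w^-1 ^+ m = w * w^-1 ^+ m.+1.
  by rewrite exprS mulrA divff ?mul1r// gt_eqF.
rewrite exprS [in X in _ < X]yE.
move: (w ^+ m) (w^-1 ^+ m.+1) x0 y0 {yE} => x y x0 y0.
have : 0 < (w - 1) * ((c%:~R - r) * x) by rewrite !mulr_gt0// subr_gt0.
have : 0 < (w - 1) * ((c%:~R + r) * y) by rewrite !mulr_gt0//; lra.
lra.
Qed.

End PellLinearForms.

(** * Auxiliary facts on integer sequences, signs and maxima *)

(** The start at 1 matches [pell_lin_step_gt0]: for [t = 2] and [c = 1], [U - c V] is 1 at both 0
    and 1. *)
Lemma homo_ltn_from1 (f : nat -> int) :
  (forall m, (0 < m)%N -> f m < f m.+1) ->
  forall m n, (0 < m)%N -> (m <= n)%N -> f m <= f n.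
Proof.
move=> fS m n m0 /subnK <-; elim: (n - m)%N => [//|j IH].
by rewrite addSn (le_trans IH)// ltW// fS// addn_gt0 m0 orbT.
Qed.

(** Each strict step between integers gains at least 1; this yields the existence of N_0. *)
Lemma ge_from1 (f : nat -> int) :
  (forall m, (0 < m)%N -> f m < f m.+1) ->
  forall m, f 1%N + m%:Z <= f m.+1.
Proof.
move=> fS; elim=> [|m IH]; first by rewrite addr0.
have := fS m.+1 isT; clear -IH; lia.
Qed.

(** A rewrite bundle which, with [expr0] and [expr1], evaluates every sign occurring for
    [l <= 4]. *)
Lemma sign_small (S : pzRingType) :
  ((-1) ^+ 2 = 1 :> S) * ((-1) ^+ 3 = -1 :> S) * ((-1) ^+ 4 = 1 :> S).
Proof. by rewrite !exprS expr0 !mulN1r !opprK. Qed.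

Lemma intr_max (S : numDomainType) (x y : int) :
  (Num.max x y)%:~R = Num.max x%:~R y%:~R :> S.
Proof. by rewrite !maxEle ler_int; case: ifP. Qed.

(** * The quantities of the theorem for a normal equation *)

Section NormalEquation.
Variables (R : realType) (k t e d : int).
Hypotheses (t_gt0 : 0 < t) (t_nsq : forall n : int, t <> n ^+ 2).

Local Notation A := (normal_equation k t e d).
Local Notation r := (@Num.sqrt R t%:~R).

Lemma lam_normal : lam R A = k%:~R.
Proof. by rewrite /lam /= intrM mulrC mulKf. Qed.

Lemma eqD_normal : eqD A = 4 * t.
Proof. by rewrite /eqD /=; ring. Qed.

Lemma eqE_normal : Defs.eqE A = 4 * t * e.
Proof. by rewrite /Defs.eqE /=; ring. Qed.

Lemma tau_normal : tau R A = t%:~R.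
Proof. by rewrite /tau eqD_normal intrM mulrC mulKf. Qed.

Lemma sqrt_tau_normal : sqrt_tau R A = r.
Proof. by rewrite /sqrt_tau tau_normal. Qed.

Lemma d2_normal : d2 R A = d%:~R.
Proof. by rewrite /d2 /= intrM mulrC mulKf. Qed.

Lemma ED_normal : ED R A = e%:~R.
Proof.
rewrite /ED eqD_normal eqE_normal intrM mulrC mulKf// intr_eq0; lia.
Qed.

Lemma pell_normal (X Y : int) : pell R A X Y <-> X ^+ 2 - t * Y ^+ 2 = 1.
Proof.
rewrite /pell tau_normal -!rmorphXn -rmorphM -rmorphB /= -[1]/(1%:~R).
by split=> [/intr_inj|->].
Qed.

Lemma pell_val_normal (X Y : int) : pell_val R A X Y = X%:~R + Y%:~R * r.
Proof. by rewrite /pell_val sqrt_tau_normal. Qed.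

Lemma int_neq_sqrt (c : int) : (r == c%:~R) = false.
Proof.
apply/eqP => rc; apply: (t_nsq (n := c)); apply: (@intr_inj R).
by rewrite rmorphXn /= -rc sqr_sqrt_int.
Qed.

Lemma is_fundamental_pell (a b : int) : is_fundamental R A a b ->
  a ^+ 2 - t * b ^+ 2 = 1.
Proof. by case=> _ _ /pell_normal. Qed.

(** The set under [inf] is bounded below by 1, so its infimum is a lower bound. *)
Lemma is_fundamental_min (a b : int) : is_fundamental R A a b ->
  forall X Y : int, X ^+ 2 - t * Y ^+ 2 = 1 ->
    1 < X%:~R + Y%:~R * r -> a%:~R + b%:~R * r <= X%:~R + Y%:~R * r.
Proof.
case=> _ _ _; rewrite !pell_val_normal => -> X Y XY z1.
apply: ge_inf; first by exists 1 => z [u [v [_ _ /ltW]]].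
by exists X, Y; rewrite pell_val_normal; split=> //; apply/pell_normal.
Qed.

Variables (a b : int).
Hypotheses (a_gt0 : 0 < a) (b_gt0 : 0 < b).
Hypothesis ab1 : a ^+ 2 - t * b ^+ 2 = 1.

Local Notation w := (a%:~R + b%:~R * r).
Local Notation U m := (pell_pow t a b m).1.
Local Notation V m := (pell_pow t a b m).2.
Local Notation kappa := (e * k - d).

Lemma pell_val_conj : pell_val R A a (- b) = w^-1.
Proof. by rewrite pell_val_normal pell_unitV// intrN mulNr. Qed.

Lemma useq_normal m : useq R A a b m = (U m)%:~R.
Proof.
rewrite /useq pell_val_conj pell_val_normal.
by rewrite (pell_powU R t_gt0 a_gt0 b_gt0 ab1); field.
Qed.

Lemma vseq_normal m : vseq R A a b m = (V m)%:~R.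
Proof.
rewrite /vseq pell_val_conj pell_val_normal sqrt_tau_normal.
by rewrite (pell_powV R t_gt0 a_gt0 b_gt0 ab1) mulrC mul1r.
Qed.

(** * The four families over the integers and the index N_0 *)

Definition sint (l m : nat) : int :=
  (-1) ^+ l./2 * U m - (-1) ^+ l.-1./2 * k * V m + kappa.

Definition tint (l m : nat) : int := (-1) ^+ l.-1./2 * V m - e.

Lemma sseq_normal l m : sseq R A a b l m = (sint l m)%:~R.
Proof.
rewrite /sseq useq_normal vseq_normal lam_normal ED_normal d2_normal.
by rewrite !(intrD, intrN, intrM, rmorphXn).
Qed.

Lemma tseq_normal l m : tseq R A a b l m = (tint l m)%:~R.
Proof.
rewrite /tseq vseq_normal ED_normal.
by rewrite !(intrD, intrN, intrM, rmorphXn).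
Qed.

(** [N0_cond] over the integers: in [sint] and in [tint], one term outweighs all the others together
    and so fixes the sign. *)
Definition dominant (m : nat) : Prop :=
  (if `|k|%:~R < r then `|k| * V m + `|kappa| < U m
   else U m < `|k| * V m - `|kappa|) /\ `|e| < V m.

Lemma N0_cond_normal m : N0_cond R A a b m <-> dominant m.
Proof.
rewrite /N0_cond /dominant useq_normal vseq_normal lam_normal ED_normal.
rewrite d2_normal sqrt_tau_normal eqE_normal eqD_normal.
have -> : `|(4 * t * e)%:~R| / (4 * t)%:~R = `|e|%:~R :> R.
  have t4 : 0 < (4 * t)%:~R :> R by rewrite ltr0z mulr_gt0.
  by rewrite intrM normrM (gtr0_norm t4) mulrC mulKf ?gt_eqF// intr_norm.
rewrite -!(intr_norm, intrM, intrB, intrD).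
by case: ifP => _; rewrite !ltr_int.
Qed.

(** N_0 is only a least index; that the condition persists is due to the monotonicity of [V] and of
    [U - |k| V] from index 1 on. *)
Lemma dominant_mono m n : (0 < m)%N -> (m <= n)%N -> dominant m -> dominant n.
Proof.
move=> m0 mn [h ev]; have Vmn : V m <= V n.
  apply: (@homo_ltn_from1 (fun i => V i)) => // i _.
  exact: (ltr_pell_powV t_gt0 a_gt0 b_gt0).
split; last exact: lt_le_trans Vmn.
case: ifPn h => kr h.
- have : U m - `|k| * V m <= U n - `|k| * V n.
    apply: (@homo_ltn_from1 (fun i => U i - `|k| * V i)) => // i i0.
    exact: (pell_lin_step_gt0 t_gt0 a_gt0 b_gt0 ab1 i0 kr).
  clear -h; lia.
- have kr' : r < `|k|%:~R by rewrite lt_neqAle int_neq_sqrt leNgt kr.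
  have : `|k| * V m - U m <= `|k| * V n - U n.
    apply: (@homo_ltn_from1 (fun i => `|k| * V i - U i)) => // i i0.
    have := pell_lin_step_lt0 t_gt0 a_gt0 b_gt0 ab1 i kr'.
    clear; lia.
  clear -h; lia.
Qed.

Lemma dominant_ex : exists m, (0 < m)%N /\ dominant m.
Proof.
(* After [M] steps the gap between [U] and [|k| V] has made up its value at index 1 and exceeds
   |kappa|; the summand |e| serves the condition on [V]. *)
pose M := absz (`|e| + `|kappa| + `|U 1 - `|k| * V 1| + 1).
have ME : M%:Z = `|e| + `|kappa| + `|U 1 - `|k| * V 1| + 1.
  by rewrite /M; clear; lia.
clearbody M.
have VM : M%:Z < V M.+1.
  by have := pell_powV_ge t_gt0 a_gt0 b_gt0 ab1 M.+1; clear; lia.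
exists M.+1; split=> //; split; last by clear -VM ME; lia.
case: ifPn => kr.
- have : U 1 - `|k| * V 1 + M%:Z <= U M.+1 - `|k| * V M.+1.
    apply: (@ge_from1 (fun i => U i - `|k| * V i)) => // i i0.
    exact: (pell_lin_step_gt0 t_gt0 a_gt0 b_gt0 ab1 i0 kr).
  clear -ME; lia.
- have kr' : r < `|k|%:~R by rewrite lt_neqAle int_neq_sqrt leNgt kr.
  have : `|k| * V 1 - U 1 + M%:Z <= `|k| * V M.+1 - U M.+1.
    apply: (@ge_from1 (fun i => `|k| * V i - U i)) => // i i0.
    have := pell_lin_step_lt0 t_gt0 a_gt0 b_gt0 ab1 i kr'.
    clear; lia.
  clear -ME; lia.
Qed.

(** * Signs and coefficients from N_0 and N_l on *)

(** For |k| > r the left-hand side is [- (p r - q)] with the [p], [q] of [dominant_coefs]: N_l is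
    the index from which [le_pell_lin] applies. *)
Lemma le_Nl l m : r < `|k|%:~R -> (Nl R A a b l <= m)%N ->
  1 + `|k|%:~R - (-1) ^+ l * (`|k|%:~R / k%:~R) * r <= 2 * r * w ^+ m.
Proof.
move=> rk; rewrite /Nl lam_normal sqrt_tau_normal.
rewrite pell_val_normal -intr_norm ltNge (ltW rk) /=.
set X := _ - _ * r; set z := _ / _.
have r0 := sqrt_int_gt0 R t_gt0.
have w1 := pell_unit_gt1 R t_gt0 a_gt0 b_gt0 ab1.
have w0 : 0 < w by lra.
(* For [X <= 0] the bound holds by sign, whatever the value of [ln X]. *)
have [X0|X0 Nm] := leP X 0.
  by move=> _; apply: le_trans X0 _; rewrite ltW// mulr_gt0 ?exprn_gt0// mulr_gt0.
have zm : z <= m%:R.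
  rewrite pmulrn; apply: le_trans (ceil_ge z) _; rewrite ler_int.
  have h (x c : int) : (absz c <= m)%N -> x <= c -> x <= m%:Z by clear; lia.
  by apply: (h _ _ Nm); rewrite le_max lexx orbT.
move: zm; rewrite /z ler_pdivrMr ?ln_gt0// [m%:R * _]mulr_natl -lnXn// lerBlDr.
rewrite -lnM ?posrE ?exprn_gt0 ?mulr_gt0//.
by rewrite ler_ln ?posrE ?mulr_gt0 ?exprn_gt0// mulrC.
Qed.

(* The sign of s_m^(l) is that of its u_m-term if |k| < r, and that of its
   v_m-term otherwise; t_m^(l) always has the sign of its v_m-term. *)
Lemma dominant_coefs l : (1 <= l <= 4)%N -> exists p q Q : int,
  [/\ [/\ Pl R A l = p%:~R * r + q%:~R, Ql R A l = Q%:~R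
        & Rl R A l = if 0 < p%:~R * r - q%:~R then 1 else 0],
      0 < p%:~R * r + q%:~R, p%:~R * r - q%:~R != 0,
      forall m, dominant m ->
        `|sint l m| + `|tint l m| = p * U m + q * V m + Q
    & forall m, (Nl R A a b l <= m)%N ->
        - (2 * r * w ^+ m) <= p%:~R * r - q%:~R < 2 * r * w ^+ m].
Proof.
move=> l14.
have r0 := sqrt_int_gt0 R t_gt0.
have r1 := sqrt_int_ge1 R t_gt0.
have w1 := pell_unit_gt1 R t_gt0 a_gt0 b_gt0 ab1.
have UV := pell_pow_ge0 t_gt0 a_gt0 b_gt0.
have wm m : r <= r * w ^+ m.
  by rewrite ler_peMr ?exprn_ege1// ltW.
have neq c : (r - c%:~R == 0) = false by rewrite subr_eq0 int_neq_sqrt.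
have neqN c : (- r - c%:~R == 0) = false.
  by rewrite -opprD oppr_eq0 -[c%:~R]opprK -intrN subr_eq0 int_neq_sqrt.
rewrite /Pl /Ql /Rl lam_normal sqrt_tau_normal ED_normal// d2_normal.
have kcases : [\/ k%:~R < - r, - r < k%:~R < r | r < k%:~R].
  have [kr|kr] := ltP k%:~R (- r); first exact: Or31.
  have [rk|rk] := ltP r k%:~R; first exact: Or33.
  apply: Or32; rewrite !lt_neqAle kr rk !andbT -subr_eq0 neqN.
  by rewrite eq_sym int_neq_sqrt.
have kV m : `|k * V m| = `|k| * V m by rewrite normrM (ger0_norm (UV m).2).
have sg := sign_small R; have sz := sign_small int.
case: kcases => [kneg|kmid|kpos].
- have k0 : k < 0 by rewrite -(ltrz0 R); lra.
  have nk : (`|k|%:~R < r) = false by rewrite intr_norm ltr0_norm ?ltrz0//; lra.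
  have domE m : dominant m ->
      [/\ U m < `|k * V m| - `|kappa|, `|e| < V m, 0 < U m & k * V m <= 0].
    rewrite /dominant nk kV => -[h1 h2]; split=> //; first exact: (UV m).1.
    by rewrite mulr_le0_ge0 ?(UV m).2// ltW.
  have NlE m : (Nl R A a b l <= m)%N -> 1 - k%:~R + (-1) ^+ l * r <= 2 * r * w ^+ m.
    have rk : r < `|k|%:~R by rewrite intr_norm ltr0_norm ?ltrz0//; lra.
    move=> /(le_Nl rk); rewrite ltr0_norm// intrN mulNr divff ?intr_eq0 ?lt_eqF//.
    by rewrite mulrN1 mulNr opprK.
  (* Both [sint] and [tint] have the sign [(-1) ^+ l.-1./2]; multiplied by it, the u_m-term gets the
     sign [(-1) ^+ l.-1]. *)
  exists ((-1) ^+ l.-1), (1 - k), ((-1) ^+ l.-1./2 * (e * k - d - e)).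
  case: l l14 NlE => [|[|[|[|[|//]]]]] // _ /= NlE; rewrite ?expr0 ?expr1 ?sg ?sz;
    (split;
    [ split;
      [ by case: ifP => h; lra
      | by case: ifP => h; lra
      | by case: ifP => [/andP[? ?]|_]; case: ifP => ? //; lra ]
    | by lra
    | by rewrite ?mulr1z ?mulrN1z ?mul1r ?mulN1r ?neq ?neqN
    | move=> m /domE[h1 h2 h3 h4];
      rewrite /sint /tint /= ?expr0 ?expr1 ?sz; clear -h1 h2 h3 h4; lia
    | move=> m /NlE; have h := wm m; rewrite ?expr0 ?expr1 ?sg => ?;
      apply/andP; split; lra ]).
- have nk : (`|k|%:~R < r) = true by rewrite intr_norm ltr_norml; case/andP: kmid => -> ->.
  have domE m : dominant m -> `|k * V m| + `|kappa| < U m /\ `|e| < V m.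
    by rewrite /dominant nk kV.
  case/andP: kmid => kmid1 kmid2.
  (* Here [sint] has the sign [(-1) ^+ l./2] and [tint] the sign [(-1) ^+ l.-1./2]. *)
  exists 1, (1 - (-1) ^+ l.-1 * k), ((-1) ^+ l./2 * (e * k - d) - (-1) ^+ l.-1./2 * e).
  case: l l14 => [|[|[|[|[|//]]]]] // _ /=; rewrite ?expr0 ?expr1 ?sg ?sz;
    (split;
    [ split;
      [ by case: ifP => h; lra
      | by case: ifP => h; lra
      | by congr (if _ then 1 else 0); apply/andP/idP => [[h1 h2]|h]; [|split]; lra ]
    | by lra
    | by rewrite mulr1z mul1r neq
    | move=> m /domE[h1 h2];
      rewrite /sint /tint /= ?expr0 ?expr1 ?sz; clear -h1 h2; lia
    | move=> m _; have h := wm m; apply/andP; split; lra ]).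
- have k0 : 0 < k by rewrite -(ltr0z R); lra.
  have nk : (`|k|%:~R < r) = false by rewrite gtr0_norm//; lra.
  have domE m : dominant m ->
      [/\ U m < `|k * V m| - `|kappa|, `|e| < V m, 0 < U m & 0 <= k * V m].
    rewrite /dominant nk kV => -[h1 h2]; split=> //; first exact: (UV m).1.
    by rewrite mulr_ge0 ?(UV m).2// ltW.
  have NlE m : (Nl R A a b l <= m)%N -> 1 + k%:~R - (-1) ^+ l * r <= 2 * r * w ^+ m.
    have rk : r < `|k|%:~R by rewrite gtr0_norm.
    by move=> /(le_Nl rk); rewrite gtr0_norm// divff ?intr_eq0 ?gt_eqF// mulr1.
  (* Here [tint] has the sign [(-1) ^+ l.-1./2] and [sint] the opposite one. *)
  exists ((-1) ^+ l), (1 + k), (- ((-1) ^+ l.-1./2 * (e * k - d + e))).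
  case: l l14 NlE => [|[|[|[|[|//]]]]] // _ /= NlE; rewrite ?expr0 ?expr1 ?sg ?sz;
    (split;
    [ split;
      [ by case: ifP => h; lra
      | by case: ifP => h; lra
      | by case: ifP => [/andP[? ?]|_]; case: ifP => ? //; lra ]
    | by lra
    | by rewrite ?mulr1z ?mulrN1z ?mul1r ?mulN1r ?neq ?neqN
    | move=> m /domE[h1 h2 h3 h4];
      rewrite /sint /tint /= ?expr0 ?expr1 ?sz; clear -h1 h2 h3 h4; lia
    | move=> m /NlE; have h := wm m; rewrite ?expr0 ?expr1 ?sg => ?;
      apply/andP; split; lra ]).
Qed.

(** * The bounds M'_l and the admissible indices *)

Lemma pell_lin_between (c : int) m K : (0 < m <= K)%N ->
  U 1 - c * V 1 <= U m - c * V m <= U K - c * V K \/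
  U K - c * V K <= U m - c * V m <= U 1 - c * V 1.
Proof.
move=> /andP[m0 mK]; have [cr|rc] := ltP c%:~R r; [left|right].
  by apply/andP; split; apply: (@homo_ltn_from1 (fun i => U i - c * V i)) => // i i0;
    exact: (pell_lin_step_gt0 t_gt0 a_gt0 b_gt0 ab1 i0 cr).
have rc' : r < c%:~R by rewrite lt_neqAle int_neq_sqrt.
have H i j : (0 < i)%N -> (i <= j)%N -> c * V i - U i <= c * V j - U j.
  apply: (@homo_ltn_from1 (fun i => c * V i - U i)) => h h0.
  by have := pell_lin_step_lt0 t_gt0 a_gt0 b_gt0 ab1 h rc'; clear; lia.
have := H 1%N m isT m0; have := H m K m0 mK; clear; lia.
Qed.

(** Up to sign and a constant, [sint] is [U - c V] with [c = k] or [c = - k], so it is monotone from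
    index 1, and an absolute value on an interval is largest at an endpoint. *)
Lemma norm_sint_le l m K : (1 <= l <= 4)%N -> (0 < m <= K)%N ->
  `|sint l m| <= Num.max `|sint l 1| `|sint l K|.
Proof.
move=> l14 mK; have sz := sign_small int; rewrite /sint.
have := pell_lin_between k mK; have := pell_lin_between (- k) mK.
move: (pell_pow t a b 1) (pell_pow t a b m) (pell_pow t a b K) => x y z.
case: l l14 => [|[|[|[|[|//]]]]] // _ /=; rewrite ?expr0 ?expr1 ?sz; clear; lia.
Qed.

Lemma norm_tint_le l m K : (1 <= l <= 4)%N -> (0 < m <= K)%N ->
  `|tint l m| <= Num.max `|tint l 1| `|tint l K|.
Proof.
move=> l14 /andP[m0 mK]; have sz := sign_small int; rewrite /tint.
have Vmono i j : (0 < i)%N -> (i <= j)%N -> V i <= V j.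
  apply: (@homo_ltn_from1 (fun i => V i)) => h h0.
  exact: (ltr_pell_powV t_gt0 a_gt0 b_gt0).
have := Vmono 1%N m isT m0; have := Vmono m K m0 mK.
move: (pell_pow t a b 1) (pell_pow t a b m) (pell_pow t a b K) => x y z.
case: l l14 => [|[|[|[|[|//]]]]] // _ /=; rewrite ?expr0 ?expr1 ?sz; clear; lia.
Qed.

Definition Mint (N0 l : nat) : int :=
  Num.max (Num.max `|sint l 1| `|sint l N0|) `|sint l (Nl R A a b l)| +
  Num.max (Num.max `|tint l 1| `|tint l N0|) `|tint l (Nl R A a b l)|.

Lemma Ml_normal N0 l : Ml R A a b N0 l = (Mint N0 l)%:~R.
Proof.
by rewrite /Ml /Mint !sseq_normal// !tseq_normal// [RHS]intrD !intr_max !intr_norm.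
Qed.

Lemma le_Mint N0 l m : (1 <= l <= 4)%N ->
  (0 < m <= maxn N0 (Nl R A a b l))%N ->
  `|sint l m| + `|tint l m| <= Mint N0 l.
Proof.
move=> l14 mK; have := norm_sint_le l14 mK; have := norm_tint_le l14 mK.
rewrite /Mint; have [_|_] := leqP N0 (Nl R A a b l); clear; lia.
Qed.

Lemma Mint_gt0 N0 l : (1 <= l <= 4)%N -> dominant N0 -> 0 < Mint N0 l.
Proof.
move=> l14 [_ eV].
have : 0 < `|tint l N0|.
  have sz := sign_small int; rewrite /tint.
  case: l l14 => [|[|[|[|[|//]]]]] // _ /=; rewrite ?expr0 ?expr1 ?sz; clear -eV; lia.
rewrite /Mint; clear; lia.
Qed.

(* The left-hand side bounds |u| + |v| at the two solutions with Y = 0. *)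
Lemma dominant_trivial n : dominant n -> exists2 l, (1 <= l <= 4)%N &
  `|kappa| + 1 + `|e| <= `|sint l n| + `|tint l n|.
Proof.
have [U0 V0] := pell_pow_ge0 t_gt0 a_gt0 b_gt0 n.
have UV : V n <= U n.
  have := pell_powP ab1 n; move: U0 V0; clear -t_gt0; nia.
have sz := sign_small int.
have kV : `|k * V n| = `|k| * V n by rewrite normrM (ger0_norm V0).
rewrite /dominant -kV => -[h ev].
have h' : `|k * V n| + `|kappa| < U n \/ U n < `|k * V n| - `|kappa|.
  by move: h; case: ifP => _; [left|right].
(* For one of the four sign patterns the three terms of [sint] agree in sign, whence |s| >= U +
   |kappa|, and [U >= V > |e|]. *)
pose bound l := `|kappa| + 1 + `|e| <= `|sint l n| + `|tint l n|.
have : bound 1%N \/ bound 2%N \/ bound 3%N \/ bound 4%N.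
  move: UV V0 ev h' {h kV U0}; rewrite /bound /sint /tint -!mulrA.
  move: (U n) (V n) (k * V n) kappa => u v g kap.
  rewrite /= ?expr0 ?expr1 ?sz !mul1r !mulN1r opprK => UV V0 ev h'.
  have [e0|e0] := leP 0 e; have [g0|g0] := leP 0 g; have [s0|s0] := leP 0 kap;
    clear -UV V0 ev h' e0 g0 s0; lia.
by case=> [H|[H|[H|H]]]; [exists 1%N|exists 2%N|exists 3%N|exists 4%N].
Qed.

(** [le_floor_pell_lin] with [K = max(N_0, N_l)]: N_0 fixes the linear form, N_l bounds the
    conjugate coefficient, and [Mint] bounds the terms up to [K]. *)
Lemma le_floor_sint_tint (n : int) N0 l :
  (1 <= l <= 4)%N -> (0 < N0)%N -> dominant N0 -> Mint N0 l <= n ->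
  let z := Num.floor ((ln (n%:~R - Rl R A l + 1 - Ql R A l) - ln (Pl R A l)
                       + ln (2 * r)) / ln w) in
  0 <= z /\
  forall m, (0 < m)%N -> (`|sint l m| + `|tint l m| <= n) = (m%:Z <= z).
Proof.
move=> l14 N00 dom Mn.
have [p [q [Q [[-> -> ->] P0 D0 fE D_bnd]]]] := dominant_coefs l14.
apply: (le_floor_pell_lin t_gt0 a_gt0 b_gt0 ab1 (K := maxn N0 (Nl R A a b l))) => //.
- by rewrite leq_max N00.
- by apply: D_bnd; rewrite leq_maxr.
- by move=> m mK; apply: le_trans Mn; exact: le_Mint.
- move=> m; rewrite geq_max => /andP[N0m _].
  by apply: fE; exact: (dominant_mono N00 N0m dom).
Qed.

(** * Enumeration of the solutions without repetition *)

Definition solution_list (z : nat -> nat) : seq (int * int) :=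
  [:: (1 + kappa, - e), (- 1 + kappa, - e) &
      [seq (sint l m, tint l m) | l <- iota 1 4, m <- iota 1 (z l)]].

Lemma size_solution_list z :
  size (solution_list z) = (2 + (z 1 + (z 2 + (z 3 + z 4))))%N.
Proof. by rewrite /= !size_cat !size_map !size_iota addn0. Qed.

Lemma mem_solution_list z p : p \in solution_list z <->
  [\/ p = (1 + kappa, - e), p = (- 1 + kappa, - e) |
      exists l m, [/\ (1 <= l <= 4)%N, (0 < m <= z l)%N
                   & p = (sint l m, tint l m)]].
Proof.
rewrite /solution_list !inE; split.
- case/or3P=> [/eqP|/eqP|/allpairsPdep[l [m [l14 mz ->]]]];
    [exact: Or31|exact: Or32|].
  by apply: Or33; exists l, m; move: l14 mz; rewrite !mem_iota !add1n !ltnS.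
- case=> [->|->|[l [m [l14 mz ->]]]]; rewrite ?eqxx ?orbT//.
  apply/or3P/Or33/allpairsPdep; exists l, m.
  by rewrite !mem_iota !add1n !ltnS.
Qed.

(** As [V > 0], the absolute value of [tint + e] is [V], which determines [m]; the signs of the two
    Pell coordinates then determine [l]. *)
Lemma sint_tint_inj l m l' m' : (1 <= l <= 4)%N -> (1 <= l' <= 4)%N ->
  (0 < m)%N -> (0 < m')%N -> sint l m = sint l' m' -> tint l m = tint l' m' ->
  l = l' /\ m = m'.
Proof.
move=> l14 l14' m0 m0'; rewrite /sint /tint.
have sz := sign_small int.
have [U0 _] := pell_pow_ge0 t_gt0 a_gt0 b_gt0 m.
have V0 := pell_powV_gt0 t_gt0 a_gt0 b_gt0 ab1 m0.
have [U0' _] := pell_pow_ge0 t_gt0 a_gt0 b_gt0 m'.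
have V0' := pell_powV_gt0 t_gt0 a_gt0 b_gt0 ab1 m0'.
move=> sE tE.
have VV : V m = V m'.
  move: tE; case: l l14 {sE} => [|[|[|[|[|//]]]]] // _;
  case: l' l14' => [|[|[|[|[|//]]]]] // _;
  rewrite /= ?expr0 ?expr1 ?sz; clear -V0 V0'; lia.
have mm := pell_powV_inj t_gt0 a_gt0 b_gt0 ab1 VV.
split=> //; subst m'.
move: sE tE; rewrite -!mulrA; move: (k * V m) (V m) (U m) U0 V0 => g v u u0 v0.
case: l l14 => [|[|[|[|[|//]]]]] // _;
  case: l' l14' => [|[|[|[|[|//]]]]] // _;
  rewrite /= ?expr0 ?expr1 ?sz; clear -u0 v0; lia.
Qed.

Lemma solution_list_uniq z : uniq (solution_list z).
Proof.
rewrite /solution_list !cons_uniq inE negb_or.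
have h x : (x, - e) \notin [seq (sint l m, tint l m) | l <- iota 1 4, m <- iota 1 (z l)].
  apply/allpairsPdep => -[l [m [l14 mz [_ tE]]]].
  rewrite !mem_iota in l14 mz.
  have V0 := pell_powV_gt0 t_gt0 a_gt0 b_gt0 ab1 (proj1 (andP mz)).
  have sz := sign_small int; move: tE; rewrite /tint.
  case: l l14 {mz} => [|[|[|[|[|//]]]]] // _; rewrite /= ?expr0 ?expr1 ?sz;
    clear -V0; lia.
rewrite !{}h !andbT; apply/andP; split.
  by apply/eqP => -[]; clear; lia.
apply: allpairs_uniq_dep; first exact: iota_uniq.
  by move=> l _; exact: iota_uniq.
move=> [l m] [l' m'] /allpairsPdep[l1 [m1 [+ + [-> ->]]]].
move=> + + /allpairsPdep[l2 [m2 [+ + [-> ->]]]] /=.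
rewrite !mem_iota => l1P /andP[m1P _] l2P /andP[m2P _] [sE tE].
by have [-> ->] := sint_tint_inj l1P l2P m1P m2P sE tE.
Qed.

Hypothesis w_min : forall X Y : int, X ^+ 2 - t * Y ^+ 2 = 1 ->
  1 < X%:~R + Y%:~R * r -> w <= X%:~R + Y%:~R * r.

Lemma satisfies_solutions (u v : int) : satisfies A (u, v) <->
  [\/ (u, v) = (1 + kappa, - e), (u, v) = (- 1 + kappa, - e) |
      exists l m, [/\ (1 <= l <= 4)%N, (0 < m)%N & (u, v) = (sint l m, tint l m)]].
Proof.
have sz := sign_small int.
rewrite satisfies_normal_form; split.
- set X := u + k * v + d; set Y := v + e.
  have uE : u = X - k * Y + kappa by rewrite /X /Y; ring.
  have vE : v = Y - e by rewrite /Y; ring.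
  rewrite uE vE; move: X Y {uE vE} => X Y XY.
  have [m mE] := pell_pow_complete t_gt0 a_gt0 b_gt0 ab1 w_min XY.
  have [XE YE] : `|X| = U m /\ `|Y| = V m by rewrite -mE.
  have [m0|m0] := posnP m.
    have [X1 Y0] : `|X| = 1 /\ `|Y| = 0 by rewrite XE YE m0.
    have -> : Y = 0 by clear -Y0; lia.
    have [->|->] : X = 1 \/ X = -1 by clear -X1; lia.
      by apply: Or31; rewrite mulr0 subr0 sub0r.
    by apply: Or32; rewrite mulr0 subr0 sub0r.
  apply: Or33; move: XE YE; rewrite /sint /tint.
  (* The sign patterns of (X, Y) for l = 1, 2, 3, 4 are (+, +), (-, +), (-, -), (+, -). *)
  have [_|_] := ger0P X; have [_|_] := ger0P Y => XE YE.
  + by exists 1%N, m; split=> //=; rewrite -XE -YE expr0 !mul1r.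
  + exists 4%N, m; split=> //=; rewrite -XE -YE expr1 sz; congr pair; ring.
  + exists 2%N, m; split=> //=; rewrite -XE -YE expr0 expr1; congr pair; ring.
  + exists 3%N, m; split=> //=; rewrite -XE -YE expr1; congr pair; ring.
- have eq1 (X Y : int) : X ^+ 2 - t * Y ^+ 2 = 1 ->
      (X - k * Y + kappa + k * (Y - e) + d) ^+ 2 - t * (Y - e + e) ^+ 2 = 1.
    by move=> <-; ring.
  case=> [[-> ->]|[-> ->]|[l [m [l14 m0 [-> ->]]]]].
  + by have := @eq1 1 0; rewrite !mulr0 !subr0 sub0r expr1n; apply.
  + by have := @eq1 (- 1) 0; rewrite !mulr0 !subr0 sub0r sz; apply.
  + have := @eq1 ((-1) ^+ l./2 * U m) ((-1) ^+ l.-1./2 * V m).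
    rewrite !exprMn !sqrr_sign !mul1r [k * (_ * V m)]mulrCA mulrA.
    by apply; exact: pell_powP.
Qed.

(** * The counting formula *)

Lemma count_sols (x : R) N0 : (0 < N0)%N -> dominant N0 ->
  \big[Num.max/0]_(1 <= l < 5) Ml R A a b N0 l <= x ->
  (#|` fset_set (sols A x)|%fset)%:Z = count_formula A a b x.
Proof.
move=> N00 dom Mx.
set n := Num.floor x.
have Mn l : (1 <= l <= 4)%N -> Mint N0 l <= n.
  move=> l14; rewrite floor_ge_int -Ml_normal//; apply: le_trans Mx.
  by apply: le_bigmax_seq => //; rewrite mem_index_iota.
pose z l := Num.floor ((ln (n%:~R - Rl R A l + 1 - Ql R A l) - ln (Pl R A l)
                       + ln (2 * r)) / ln w).
have zP l : (1 <= l <= 4)%N -> 0 <= z l /\ forall m, (0 < m)%N ->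
    (`|sint l m| + `|tint l m| <= n) = (m%:Z <= z l).
  by move=> l14; apply: (le_floor_sint_tint l14 N00 dom); exact: Mn.
pose s := solution_list (fun l => absz (z l)).
have sE : fset_set (sols A x) = [fset p in s]%fset.
  apply/fsetP => -[u v]; rewrite (in_fset_set (finite_sols A x)) in_fset.
  (* Both solutions with Y = 0 are counted: their size is at most that of a family term of index
     N_0, hence at most some M'_l. *)
  have triv : `|kappa| + 1 + `|e| <= n.
    have [l l14 le_l] := dominant_trivial dom.
    apply: le_trans le_l (le_trans _ (Mn l l14)).
    by apply: le_Mint => //; rewrite N00 leq_max leqnn.
  apply/idP/idP.
  - move=> /set_mem[/satisfies_solutions + /=]; rewrite -floor_ge_int -/n.
    move=> uv uvn; apply/mem_solution_list.
    case: uv => [h|h|[l [m [l14 m0 uvE]]]]; [exact: Or31|exact: Or32|apply: Or33].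
    exists l, m; split=> //; rewrite m0 /=; case: uvE uvn => -> ->.
    have [z0 ->//] := zP l l14.
    by move: z0; clear; lia.
  - move=> /mem_solution_list uv; apply/mem_set; split.
      apply/satisfies_solutions; case: uv => [h|h|[l [m [l14 /andP[m0 _] uvE]]]];
        [exact: Or31|exact: Or32|apply: Or33].
      by exists l, m.
    rewrite /= -floor_ge_int -/n.
    case: uv => [[-> ->]|[-> ->]|[l [m [l14 /andP[m0 mz] [-> ->]]]]].
    + by clear -triv; lia.
    + by clear -triv; lia.
    + have [z0 ->//] := zP l l14.
      by move: z0 mz; clear; lia.
rewrite sE card_fseq undup_id ?solution_list_uniq// size_solution_list.
have sum5 (F : nat -> int) :
    \sum_(1 <= l < 5) F l = F 1%N + (F 2%N + (F 3%N + F 4%N)).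
  by do 4 rewrite big_ltn//; rewrite big_geq// addr0.
rewrite /count_formula sum5 pell_val_normal sqrt_tau_normal -/n.
rewrite -/(z 1%N) -/(z 2%N) -/(z 3%N) -/(z 4%N).
(* The four floors are nonnegative, so [absz] leaves them unchanged. *)
move: (zP 1%N isT).1 (zP 2%N isT).1 (zP 3%N isT).1 (zP 4%N isT).1.
clear; move: (z 1%N) (z 2%N) (z 3%N) (z 4%N) => z1 z2 z3 z4; lia.
Qed.

End NormalEquation.

Theorem theorem1p4 (R : realType) (A : equation) (alpha beta : int)
    (hA : in_Z1 A) (hfund : is_fundamental R A alpha beta) :
  (exists L : nat, (0 < L)%N /\
     forall x : R, L%:R <= x ->
       (#|` fset_set (sols A x)|%fset)%:Z = count_formula A alpha beta x)
  /\
  (exists N0 : nat,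
     [/\ is_N0 R A alpha beta N0,
         forall l : nat, (1 <= l <= 4)%N ->
           exists2 M : nat, (0 < M)%N & Ml R A alpha beta N0 l = M%:R &
         forall x : R,
           \big[Num.max/0]_(1 <= l < 5) Ml R A alpha beta N0 l <= x ->
           (#|` fset_set (sols A x)|%fset)%:Z = count_formula A alpha beta x]).
Proof.
have [k [t [e [d [AE t_gt0 t_nsq]]]]] := Z1_normal_form hA.
subst A.
have [a_gt0 b_gt0 _ _] := hfund.
have ab1 := is_fundamental_pell hfund.
have w_min := is_fundamental_min hfund.
have [N0 [[N00 N0P] N0min]] : exists N0,
    [/\ (0 < N0)%N /\ dominant R k t e d alpha beta N0 &
      forall m, (0 < m)%N -> dominant R k t e d alpha beta m -> (N0 <= m)%N].
  have ex : exists m, `[< (0 < m)%N /\ dominant R k t e d alpha beta m >].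
    have [m mP] := dominant_ex R k e d t_gt0 t_nsq a_gt0 b_gt0 ab1.
    by exists m; apply/asboolP.
  exists (ex_minn ex); case: ex_minnP => m /asboolP mP mmin; split=> // j j0 jP.
  by apply: mmin; apply/asboolP.
have count x := count_sols t_gt0 t_nsq a_gt0 b_gt0 ab1 w_min (x := x) N00 N0P.
split.
  set M := \big[Num.max/0]_(1 <= l < 5) Ml R _ alpha beta N0 l in count.
  (* Any positive natural number above all M'_l will do. *)
  exists (Num.bound `|M|).+1; split=> // x xL; apply: count.
  apply: le_trans xL; rewrite (le_trans (ler_norm _))//.
  apply: le_trans (ltW (archi_boundP (normr_ge0 M))) _.
  by rewrite ler_nat.
exists N0; split=> //.
  split=> //; first exact/(N0_cond_normal R k e d t_gt0 a_gt0 b_gt0 ab1).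
  move=> m m0 /(N0_cond_normal R k e d t_gt0 a_gt0 b_gt0 ab1); exact: N0min.
move=> l l14; rewrite Ml_normal//.
have M0 := Mint_gt0 l14 N0P.
exists (absz (Mint R k t e d alpha beta N0 l)); first by move: M0; clear; lia.
by rewrite natr_absz ger0_norm// ltW.
Qed.
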